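(* Let $n$ be a positive integer. If two $m$-component welded string links $\sigma$ and $\sigma'$ are $(V^{n}+\mathrm{sv})$-equivalent, then $\mu^{\mathrm w}_{\sigma}(I)\equiv\mu^{\mathrm w}_{\sigma'}(I)\pmod n$ for every non-repeated sequence $I$ of elements of $\{1,\dots,m\}$.
   Context: Welded string links: equivalence classes of ordered oriented $m$-strand virtual string link diagrams (double points classical or virtual crossings) under welded Reidemeister moves R1–R3, V1–V4 and OC (welded isotopy). Welded Milnor invariants: label the arcs of the $i$th strand $a_{i1},\dots,a_{ir(i)}$ in order (arcs end at classical undercrossings); the Wirtinger presentation of $G(\sigma)$ has relations $a_{i,j+1}^{-1}u_{ij}^{-1}a_{ij}u_{ij}$ with $u_{ij}$ the over-arc generator at the relevant crossing or its inverse according to the crossing sign. Set $v_{ij}=u_{i1}\cdots u_{ij}$ and $l_i=a_{i1}^{s}v_{i,r(i)-1}$ with $s$ such that the total exponent of $i$th-component generators in $l_i$ is zero. Modulo the $q$th lower central series term, $l_i$ is a word $\lambda_i$ in the images $\alpha_1,\dots,\alpha_m$ of $a_{11},\dots,a_{m1}$; with Magnus expansion $E(\alpha_i)=1+X_i$, $E(\alpha_i^{-1})=\sum_{t\ge0}(-X_i)^t$ in $\mathbb Z\langle\langle X_1,\dots,X_m\rangle\rangle$, $\mu^{\mathrm w}_\sigma(j_1\dots j_k i)$ ($k<q$) is the coefficient of $X_{j_1}\cdots X_{j_k}$ in $E(\lambda_i)$. A sequence is non-repeated if its entries are pairwise distinct. A $V^n$-move: on two oriented strands in a disk, replace two parallel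 crossingless strands by a configuration where one strand passes under the other $n$ times consecutively at classical crossings of the same sign, crossing back via a virtual crossing after each (and the inverse). Self-crossing virtualization: replace a classical crossing between strands of the same component by a virtual one, or conversely. $(V^n+\mathrm{sv})$-equivalence is generated by $V^n$-moves, self-crossing virtualizations and welded isotopy. *)

(* Defs.v *)
(* Welded string links are modelled by Gauss diagrams on m
   ordered oriented intervals (strands). *)
From mathcomp Require Import all_boot all_order all_algebra.
From Stdlib Require Import Relations.Relation_Operators.
Set Implicit Arguments. Unset Strict Implicit. Unset Printing Implicit Defensive.
Import Order.TTheory GRing.Theory Num.Theory.

(* An endpoint of an arrow: ((label, is_head), sign).  A tail (is_head=false)
   is the over-passing point of a classical crossing, a head (is_head=true) the
   under-passing point; sign=true means a positive crossing. *)
Definition ep := ((nat * bool) * bool)%type.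
Definition lab (e : ep) : nat := e.1.1.
Definition is_head (e : ep) : bool := e.1.2.
Definition esign (e : ep) : bool := e.2.
Definition tl (a : nat) (s : bool) : ep := ((a, false), s).
Definition hd (a : nat) (s : bool) : ep := ((a, true), s).
Definition ep0 : ep := ((0, false), false).

(* strand i = the list of endpoints met along the i-th strand (0-based),
   in the order given by the orientation *)
Definition diagram := seq (seq ep).

Definition wf (D : diagram) : Prop :=
  let E := flatten D in
  uniq [seq e.1 | e <- E] /\
  (forall e, e \in E -> ((lab e, ~~ is_head e), esign e) \in E).

Definition remove_labs (L : seq nat) (D : diagram) : diagram :=
  map (filter (fun e => lab e \notin L)) D.

Definition ent (D : diagram) (i p : nat) : ep := nth ep0 (nth [::] D i) p.

Definition swap_adj (D : diagram) (i p : nat) : diagram :=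
  let s := nth [::] D i in
  set_nth [::] D i (set_nth ep0 (set_nth ep0 s p (nth ep0 s p.+1)) p.+1 (nth ep0 s p)).

Definition in_range (D : diagram) (i p : nat) : bool :=
  (i < size D) && (p.+1 < size (nth [::] D i)).

Definition R1move (D D' : diagram) : Prop :=
  exists a eps, D = remove_labs [:: a] D' /\
   exists2 s, s \in D' &
     infix [:: tl a eps; hd a eps] s || infix [:: hd a eps; tl a eps] s.

Definition R2move (D D' : diagram) : Prop :=
  exists a b eps, a != b /\ D = remove_labs [:: a; b] D' /\
   (exists2 s, s \in D' & infix [:: hd a eps; hd b (~~ eps)] s) /\
   (exists2 s, s \in D' & infix [:: tl a eps; tl b (~~ eps)] s
                           || infix [:: tl b (~~ eps); tl a eps] s).

Definition pair_at (D : diagram) (i p : nat) (o : bool) (e1 e2 : ep) : Prop :=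
  in_range D i p /\
  (if o then ent D i p = e1 /\ ent D i p.+1 = e2
        else ent D i p = e2 /\ ent D i p.+1 = e1).

(* R3: triangle of arrows x (top->middle), y (top->bottom), z (middle->bottom);
   the three pairs of adjacent endpoints are all swapped.  The sign condition
   (derived from the planar picture) is
     eps_x eps_y = o_M o_B   and   eps_x eps_z = - o_T o_B,
   where o_T : t_y before t_x, o_M : h_x before t_z, o_B : h_y before h_z. *)
Definition R3move (D D' : diagram) : Prop :=
  exists (x y z : nat) (ex ey ez oT oM oB : bool) (iT pT iM pM iB pB : nat),
    uniq [:: x; y; z] /\
    pair_at D iT pT oT (tl y ey) (tl x ex) /\
    pair_at D iM pM oM (hd x ex) (tl z ez) /\
    pair_at D iB pB oB (hd y ey) (hd z ez) /\
    (ex == ey) = (oM == oB) /\ (ex == ez) = (oT != oB) /\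
    D' = swap_adj (swap_adj (swap_adj D iT pT) iM pM) iB pB.

Definition OCmove (D D' : diagram) : Prop :=
  exists i p, in_range D i p /\ ~~ is_head (ent D i p) /\
    ~~ is_head (ent D i p.+1) /\ D' = swap_adj D i p.

Definition relabel (D D' : diagram) : Prop :=
  exists f : nat -> nat, injective f /\
    D' = map (map (fun e : ep => ((f (lab e), is_head e), esign e))) D.

Definition Vn_move (n : nat) (D D' : diagram) : Prop :=
  exists (L : seq nat) (eps : bool), uniq L /\ size L = n /\
    D = remove_labs L D' /\
    (exists2 s, s \in D' & infix [seq hd a eps | a <- L] s) /\
    (exists2 s, s \in D' & infix [seq tl a eps | a <- L] s).

(* self-crossing virtualization: remove an arrow with both endpoints on the
   same strand (= same component of a string link) *)
Definition sv_move (D D' : diagram) : Prop :=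
  exists a eps, D = remove_labs [:: a] D' /\
    exists2 s, s \in D' & (tl a eps \in s) && (hd a eps \in s).

Definition Vn_sv_step (n : nat) (D D' : diagram) : Prop :=
  wf D /\ wf D' /\
  (R1move D D' \/ R2move D D' \/ R3move D D' \/ OCmove D D' \/ relabel D D'
   \/ Vn_move n D D' \/ sv_move D D').

Definition Vn_sv_equiv (n : nat) : diagram -> diagram -> Prop :=
  clos_refl_sym_trans diagram (Vn_sv_step n).

Local Open Scope ring_scope.
(* words in the free group on alpha_0..alpha_{m-1}: (generator, inverted?) *)
Definition word := seq (nat * bool).
Definition winv (w : word) : word := rev [seq (x.1, ~~ x.2) | x <- w].

Definition heads (D : diagram) (k : nat) : seq ep :=
  filter is_head (nth [::] D k).

(* (strand, arc index) of the over-arc at the tail of arrow a; arcs of a strand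
   are numbered 0,1,... and a new arc starts after each head (undercrossing) *)
Definition tail_loc (D : diagram) (a : nat) : nat * nat :=
  let k := find (fun s => has (fun e : ep => e.1 == (a, false)) s) D in
  let s := nth [::] D k in
  let p := find (fun e : ep => e.1 == (a, false)) s in
  (k, count is_head (take p s)).

Definition uword (D : diagram) (f : nat -> nat -> word) (e : ep) : word :=
  let kl := tail_loc D (lab e) in
  if esign e then f kl.1 kl.2 else winv (f kl.1 kl.2).

(* arcw D p k l : depth-p approximation (in the free group, correct modulo the
   (p+2)-nd lower central series term) of the image of arc l of strand k,
   obtained by iterating a_{k,l} = v_{k,l}^{-1} a_{k,0} v_{k,l} *)
Fixpoint arcw (D : diagram) (p k l : nat) : word :=
  match p with
  | 0 => [:: (k, false)]
  | p'.+1 =>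
      let v := flatten [seq uword D (arcw D p') e | e <- take l (heads D k)] in
      winv v ++ (k, false) :: v
  end.

Definition vword (D : diagram) (p k l : nat) : word :=
  flatten [seq uword D (arcw D p) e | e <- take l (heads D k)].

Definition sgn (b : bool) : int := if b then 1 else -1.

(* the exponent s making the total exponent of component-i generators zero *)
Definition longitude_exp (D : diagram) (i : nat) : int :=
  - \sum_(e <- heads D i | (tail_loc D (lab e)).1 == i) sgn (esign e).

Definition gen_pow (i : nat) (s : int) : word :=
  match s with
  | Posz k => nseq k (i, false)
  | Negz k => nseq k.+1 (i, true)
  end.

Definition longitude (D : diagram) (p i : nat) : word :=
  gen_pow i (longitude_exp D i) ++ vword D p i (size (heads D i)).

(* Magnus expansion: E(alpha_i) = 1 + X_i, E(alpha_i^-1) = sum_t (-X_i)^t *)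
Definition letter_coef (x : nat * bool) (M : seq nat) : int :=
  if x.2 then (if all (pred1 x.1) M then (-1) ^+ size M else 0)
  else (if M == [::] then 1 else if M == [:: x.1] then 1 else 0).

(* coefficient of X_{M_1}...X_{M_k} in E(w) *)
Fixpoint mcoef (w : word) (M : seq nat) : int :=
  match w with
  | [::] => (M == [::])%:R
  | x :: w' => \sum_(t < (size M).+1) letter_coef x (take t M) * mcoef w' (drop t M)
  end.

(* mu^w_D(j_1 ... j_k i), strands numbered from 0; the depth size I is
   more than enough for the coefficient of a degree-k monomial *)
Definition mu_w (D : diagram) (I : seq nat) : int :=
  match I with
  | [::] => 0
  | x :: I' => mcoef (longitude D (size I) (last x I')) (belast x I')
  end.

(* Main.v *)
(** Let x be a family of elements of a group G, indexed by the strands.  Colour the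
    arcs of a diagram by elements of G so that the Wirtinger relations hold and the
    first arc of strand k gets x k.  If G is nilpotent, there is exactly one such
    colouring: y ^ a and y ^ b agree one step further down the lower central series
    than a and b do, so the Wirtinger relations are a contraction, and its iterates
    are the values of the words [arcw].  Every move transports colourings, and keeps
    the product of the over-arc colours along strand i, the image of the longitude,
    provided that x k commutes with its conjugates (so that self-crossings have no
    effect on the colours), x k ^+ n = 1 (for V^n-moves) and x i = 1 (so that
    self-crossings of strand i, and the framing correction, do not contribute).
    For a non-repeated monomial M = X_{j_1} ... X_{j_d} without X_i, these conditions
    hold in the group of unitriangular matrices of size d + 1 over Z/n for
    x k = 1 + N_k, where N_k is the elementary matrix E_{s,s+1} if j_s = k and 0 if k
    does not occur in M; the coefficient of M in a Magnus expansion is the corner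
    entry of the corresponding matrix. *)
Require Import Defs.
From mathcomp Require Import all_boot all_order all_algebra all_fingroup all_solvable.
Set Implicit Arguments.
Unset Strict Implicit.
Unset Printing Implicit Defensive.
Import GRing.Theory.

Local Notation strand D k := (nth [::] D k).

Section Endpoints.
Implicit Types (D : diagram) (e : ep) (L : seq nat).

Lemma head_key e : is_head e -> e.1 = (lab e, true).
Proof. by case: e => -[a b] sg; rewrite /is_head /lab /= => ->. Qed.

Lemma mem_strand_flatten D k e : e \in strand D k -> e \in flatten D.
Proof.
case: (ltnP k (size D)) => [ltkD|?]; last by rewrite nth_default.
by move=> ek; apply/flattenP; exists (strand D k) => //; apply: mem_nth.
Qed.

Lemma mem_flatten_strand D e : e \in flatten D -> exists k, e \in strand D k.
Proof. by case/flattenP=> _ /(nthP [::]) [k _ <-]; exists k. Qed.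

Lemma strand_map (h : seq ep -> seq ep) D k : h [::] = [::] ->
  strand (map h D) k = h (strand D k).
Proof.
move=> h0; case: (ltnP k (size D)) => [ltkD|?]; first by rewrite (nth_map [::]).
by rewrite !nth_default ?size_map.
Qed.

Lemma strand_remove_labs L D k :
  strand (remove_labs L D) k = [seq e <- strand D k | lab e \notin L].
Proof. exact: strand_map. Qed.

Lemma infix_strand D B : (exists2 s, s \in D & infix B s) ->
  exists k P Q, strand D k = P ++ B ++ Q.
Proof. by case=> _ /(nthP [::]) [k _ <-] /infixP [P [Q splitE]]; exists k, P, Q. Qed.

Definition unique_endpoints D : Prop :=
  (forall k, uniq [seq e.1 | e <- strand D k]) /\
  (forall k k' e e', e \in strand D k -> e' \in strand D k' -> e.1 = e'.1 -> k = k').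

Lemma wf_unique_endpoints D : wf D -> unique_endpoints D.
Proof.
case=> + _; elim: D => [|s D IH]; first by split=> [k|k k' e e']; rewrite nth_nil.
rewrite /= map_cat cat_uniq => /and3P[uniq_s /hasPn disj /IH [uniqD sameD]].
have sep e e' k : e \in s -> e' \in strand D k -> e.1 <> e'.1.
  move=> es /mem_strand_flatten e'D ee'; have /negP := disj _ (map_f fst e'D); apply.
  by rewrite -ee' /=; apply: map_f.
split=> [[|k]|[|k] [|k'] e e'] //=.
- by move=> es e'D /(sep _ _ _ es e'D).
- by move=> eD e's /esym /(sep _ _ _ e's eD).
by move=> eD e'D ee'; congr S; apply: sameD eD e'D ee'.
Qed.

Lemma wf_tail D e : wf D -> e \in flatten D ->
  exists k s1 s2, strand D k = s1 ++ tl (lab e) (esign e) :: s2.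
Proof.
case=> _ closedD eD; have [k tail_k] : exists k, tl (lab e) (esign e) \in strand D k.
  apply: mem_flatten_strand; have := closedD e eD.
  by case: e eD => -[a []] sg; rewrite /is_head.
by exists k; case/splitPr: tail_k => s1 s2; exists s1, s2.
Qed.

Lemma unique_endpoints_cat D k s1 e s2 : unique_endpoints D ->
  strand D k = s1 ++ e :: s2 ->
  e.1 \notin [seq e'.1 | e' <- s1] /\ e.1 \notin [seq e'.1 | e' <- s2].
Proof.
case=> /(_ k) + _ splitE; rewrite splitE map_cat cat_uniq /= => /and3P[_ /norP[-> _]].
by case/andP.
Qed.

Lemma tail_locE D k s1 a sg s2 : unique_endpoints D ->
  strand D k = s1 ++ tl a sg :: s2 -> tail_loc D a = (k, count is_head s1).
Proof.
move=> uD splitE; rewrite /tail_loc; set has_tail := fun s : seq ep => has _ s.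
have tail_k : tl a sg \in strand D k by rewrite splitE mem_cat mem_head orbT.
have hasD : has has_tail D.
  have ltkD : k < size D.
    by rewrite ltnNge; apply/negP => ?; move: tail_k; rewrite nth_default.
  by apply/hasP; exists (strand D k); [apply: mem_nth | apply/hasP; exists (tl a sg)].
have -> : find has_tail D = k.
  have /hasP[e e_in /eqP ea] := nth_find [::] hasD.
  exact: (uD.2 _ _ _ _ e_in tail_k).
have [tail_s1 _] := unique_endpoints_cat uD splitE.
congr pair; rewrite splitE find_cat ifN.
  by rewrite /= eqxx addn0 take_size_cat.
by apply: contra tail_s1 => /hasP[e es1 /eqP key_e]; rewrite -[(tl a sg).1]key_e map_f.
Qed.

Lemma take_count_heads D k s1 s2 : strand D k = s1 ++ s2 ->
  take (count is_head s1) (heads D k) = filter is_head s1.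
Proof.
by move=> splitE; rewrite /heads splitE filter_cat take_size_cat // size_filter.
Qed.

Lemma keys_off_block D k P B Q : unique_endpoints D -> strand D k = P ++ B ++ Q ->
  let off e := e.1 \notin [seq e'.1 | e' <- B] in
  [/\ all off P, all off Q & forall j, j != k -> all off (strand D j)].
Proof.
move=> [uniqD sameD] splitE /=; split.
- apply/allP => e eP; have := uniqD k; rewrite splitE !map_cat cat_uniq has_cat negb_or.
  case/and3P=> _ /andP[/hasPn disj _] _.
  by apply/negP => /disj /negP; apply; apply: map_f.
- apply/allP => e eQ; have := uniqD k; rewrite splitE !map_cat !cat_uniq.
  by case/and3P=> _ _ /and3P[_ /hasPn disj _]; apply: disj (map_f _ eQ).
move=> j /eqP j_k; apply/allP => e ej; apply/negP => /mapP[e' e'B ee']; apply: j_k.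
by apply: sameD ej _ ee'; rewrite splitE !mem_cat e'B orbT.
Qed.

Lemma head_label_notin B e : all is_head B -> is_head e ->
  e.1 \notin [seq e'.1 | e' <- B] -> lab e \notin map lab B.
Proof.
move=> /allP headsB he; apply: contra => /mapP[e' e'B labE].
by rewrite (head_key he) labE -(head_key (headsB _ e'B)) map_f.
Qed.

End Endpoints.

Section Swaps.
Implicit Types (D : diagram) (e : ep) (o : bool).

Definition ordered_pair o e1 e2 : seq ep := if o then [:: e1; e2] else [:: e2; e1].

Lemma set_nth_cat_size (T : Type) (x0 : T) s1 x y s2 :
  set_nth x0 (s1 ++ x :: s2) (size s1) y = s1 ++ y :: s2.
Proof. by elim: s1 => //= z s1 ->. Qed.

Lemma pair_at_strands D i p o e1 e2 : pair_at D i p o e1 e2 ->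
  exists s1 s2, strand D i = s1 ++ ordered_pair o e1 e2 ++ s2 /\
    forall k, strand (swap_adj D i p) k =
      if k == i then s1 ++ ordered_pair (~~ o) e1 e2 ++ s2 else strand D k.
Proof.
case=> /andP[lt_i lt_p]; rewrite /swap_adj /ent; set s := strand D i in lt_p *.
set a := nth ep0 s p; set b := nth ep0 s p.+1 => ab.
have splitE : s = take p s ++ [:: a; b] ++ drop p.+2 s.
  by rewrite /= -(drop_nth ep0 lt_p) -(drop_nth ep0 (ltnW lt_p)) cat_take_drop.
have size_s1 : size (take p s) = p by rewrite size_take ltnW.
exists (take p s), (drop p.+2 s); split=> [|k].
  by rewrite {1}splitE; case: o ab => -[-> ->].
rewrite nth_set_nth /=; case: ifP => // _.
have -> : ordered_pair (~~ o) e1 e2 = [:: b; a] by case: o ab => -[-> ->].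
move: (take p s) (drop p.+2 s) splitE size_s1 => s1 s2 -> <-.
by rewrite set_nth_cat_size -cat_rcons -(size_rcons s1 b) set_nth_cat_size cat_rcons.
Qed.

Lemma swap_adj_perm D i p o e1 e2 k : pair_at D i p o e1 e2 ->
  perm_eq (strand (swap_adj D i p) k) (strand D k).
Proof.
case/pair_at_strands=> s1 [s2 [splitE ->]]; case: eqP => [->|//].
rewrite splitE perm_cat2l perm_cat2r.
by case: o {splitE}; rewrite (perm_catC [:: _] [:: _]).
Qed.

Lemma unique_endpoints_swap D i p o e1 e2 : pair_at D i p o e1 e2 ->
  unique_endpoints D -> unique_endpoints (swap_adj D i p).
Proof.
move=> pairD [uniqD sameD]; have permD k := swap_adj_perm k pairD.
split=> [k|k k' e e']; first by rewrite (perm_uniq (perm_map _ (permD k))).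
by rewrite !(perm_mem (permD _)); apply: sameD.
Qed.

Lemma ent_swap D i p j q : in_range D i p ->
  ent D j q \notin [:: ent D i p; ent D i p.+1] ->
  ent (swap_adj D i p) j q = ent D j q.
Proof.
move=> /andP[lt_i lt_p]; rewrite !inE => /norP[ne1 ne2].
rewrite {1}/ent /swap_adj nth_set_nth /=; case: eqP => [ji|//].
rewrite nth_set_nth /=; case: eqP => [qp|_]; first by case/eqP: ne2; rewrite ji qp.
rewrite nth_set_nth /=; case: eqP => [qp|_]; last by rewrite ji.
by case/eqP: ne1; rewrite ji qp.
Qed.

Lemma pair_at_swap D i p o f1 f2 j q o' e1 e2 :
  pair_at D i p o f1 f2 -> pair_at D j q o' e1 e2 ->
  e1 \notin [:: f1; f2] -> e2 \notin [:: f1; f2] ->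
  pair_at (swap_adj D i p) j q o' e1 e2.
Proof.
move=> pairD [rng ents] ne1 ne2; have [rngD swapped] := pairD; split.
  rewrite /in_range (perm_size (swap_adj_perm j pairD)).
  by rewrite size_set_nth; case/andP: rngD => lt_i _; rewrite (maxn_idPr lt_i).
have moved e : e \notin [:: f1; f2] -> e \notin [:: ent D i p; ent D i p.+1].
  by case: o swapped {pairD} => -[-> ->] //; rewrite !inE orbC.
by case: o' ents => -[ent1 ent2]; rewrite !ent_swap // ?ent1 ?ent2 //; apply: moved.
Qed.

End Swaps.

Section WordEvaluation.
Local Open Scope group_scope.
Context (G : groupType) (x : nat -> G).
Implicit Types (g h : G) (b : bool) (w : word).

Definition signg b g : G := if b then g else g^-1.

Lemma signgN b g : signg (~~ b) g = (signg b g)^-1.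
Proof. by case: b; rewrite /= ?invgK. Qed.

Lemma signgJ b g h : signg b (g ^ h) = signg b g ^ h.
Proof. by case: b; rewrite //= conjVg. Qed.

Lemma signgX b g n : signg b g ^+ n = signg b (g ^+ n).
Proof. by case: b; rewrite //= expVgn. Qed.

Lemma signg1 b : signg b 1 = 1.
Proof. by case: b; rewrite /= ?invg1. Qed.

Lemma commute_signg b g h : commute g h -> commute g (signg b h).
Proof. by case: b => //; apply: commuteV. Qed.

Definition eval_word w : G := \prod_(z <- w) signg (~~ z.2) (x z.1).

Lemma eval_cons z w : eval_word (z :: w) = signg (~~ z.2) (x z.1) * eval_word w.
Proof. exact: big_cons. Qed.

Lemma eval_cat w1 w2 : eval_word (w1 ++ w2) = eval_word w1 * eval_word w2.
Proof. exact: big_cat. Qed.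

Lemma eval_winv w : eval_word (winv w) = (eval_word w)^-1.
Proof.
rewrite /eval_word -[in RHS](revK w) -prodgV /winv -map_rev big_map.
by apply: eq_bigr => z _; rewrite signgN.
Qed.

Lemma eval_gen_pow i s : x i = 1 -> eval_word (gen_pow i s) = 1.
Proof.
by move=> xi1; case: s => k; rewrite /eval_word big_nseq iter_mulg_1 /= xi1 ?invg1 expg1n.
Qed.

End WordEvaluation.

Section Colourings.
Local Open Scope group_scope.
Context (G : groupType) (x : nat -> G).
Implicit Types (C : nat * bool -> G) (D : diagram) (e : ep) (s : seq ep) (y : G).

(* C (a, false) and C (a, true) are the colours read at the tail and at the head of
   arrow a.  They agree in a colouring, but the intermediate steps of an R3 move
   respect only the conditions along the strands. *)
Definition headval C e : G := signg (esign e) (C e.1).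

Definition holonomy C s : G := \prod_(e <- s | is_head e) headval C e.

Fixpoint strand_coloured C y s : bool :=
  if s is e :: s' then
    if is_head e then strand_coloured C (y ^ headval C e) s'
    else (C e.1 == y) && strand_coloured C y s'
  else true.

Definition strands_coloured C D : Prop := forall k, strand_coloured C (x k) (strand D k).

Definition colouring D C : Prop :=
  strands_coloured C D /\ forall a, C (a, true) = C (a, false).

Lemma holonomy_cat C s1 s2 : holonomy C (s1 ++ s2) = holonomy C s1 * holonomy C s2.
Proof. exact: big_cat. Qed.

Lemma strand_coloured_cat C y s1 s2 :
  strand_coloured C y (s1 ++ s2) =
  strand_coloured C y s1 && strand_coloured C (y ^ holonomy C s1) s2.
Proof.
elim: s1 y => [|e s1 IH] y; first by rewrite /holonomy big_nil conjg1.
rewrite /holonomy big_cons /=; case: (is_head e); first by rewrite IH conjgM.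
by rewrite IH andbA.
Qed.

Lemma strand_coloured_tails C y s : all (predC is_head) s ->
  strand_coloured C y s = all (fun e => C e.1 == y) s.
Proof. by elim: s => //= e s IH /andP[/negPf -> /IH ->]. Qed.

Lemma strand_colouredP C y s :
  reflect (forall s1 a sg s2, s = s1 ++ tl a sg :: s2 -> C (a, false) = y ^ holonomy C s1)
          (strand_coloured C y s).
Proof.
apply: (iffP idP) => [col s1 a sg s2 splitE | tailE].
  by move: col; rewrite splitE strand_coloured_cat => /and3P[_ /eqP].
elim: s y tailE => //= e s IH y tailE; case: ifPn => he.
  apply: IH => s1 a sg s2 splitE; rewrite (tailE (e :: s1) a sg s2) ?splitE //.
  by rewrite /holonomy big_cons he conjgM.
case: e he tailE => -[a []] sg //= _ tailE; rewrite (tailE [::] a sg s) //.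
rewrite /holonomy big_nil conjg1 eqxx; apply: IH => s1 a' sg' s2 splitE.
by rewrite (tailE (tl a sg :: s1) a' sg' s2) ?splitE // /holonomy big_cons.
Qed.

Lemma eq_strand_coloured C C' y s : {in s, forall e, C' e.1 = C e.1} ->
  strand_coloured C' y s = strand_coloured C y s.
Proof.
elim: s y => //= e s IH y eqC; rewrite /headval eqC ?mem_head //.
by rewrite !IH // => e' e's; apply: eqC; rewrite inE e's orbT.
Qed.

Lemma eq_holonomy C C' s : {in s, forall e, C' e.1 = C e.1} ->
  holonomy C' s = holonomy C s.
Proof.
move=> eqC; rewrite /holonomy big_seq_cond [RHS]big_seq_cond.
by apply: eq_bigr => e /andP[es _]; rewrite /headval eqC.
Qed.

Lemma strand_coloured_filter C y (p : pred ep) s : {in s, forall e, is_head e -> p e} ->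
  strand_coloured C y s -> strand_coloured C y (filter p s).
Proof.
elim: s y => //= e s IH y keep.
have {}IH y' : strand_coloured C y' s -> strand_coloured C y' (filter p s).
  by apply: IH => e' e's; apply: keep; rewrite inE e's orbT.
have := keep e (mem_head _ _); case: ifP => he.
  by move=> -> //= /IH; rewrite he.
by case: ifP => _ _ /andP[Ce /IH] //=; rewrite he Ce.
Qed.

Lemma holonomy_filter C (p : pred ep) s : {in s, forall e, is_head e -> p e} ->
  holonomy C (filter p s) = holonomy C s.
Proof.
move=> keep; rewrite /holonomy big_filter_cond big_seq_cond [RHS]big_seq_cond.
apply: eq_bigl => e; case es: (e \in s) => //=.
by case he: (is_head e); rewrite ?andbF // keep.
Qed.

(* Here f (k, l) stands for the image of arc l of strand k: the fixed points of
   [wirtinger D] are the solutions of the Wirtinger relations. *)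
Definition underpass D (f : nat * nat -> G) k l : G :=
  \prod_(e <- take l (heads D k)) signg (esign e) (f (tail_loc D (lab e))).

Definition wirtinger D f (kl : nat * nat) : G := x kl.1 ^ underpass D f kl.1 kl.2.

Lemma underpass_holonomy D f C k s1 s2 : strand D k = s1 ++ s2 ->
  {in s1, forall e, is_head e -> C e.1 = f (tail_loc D (lab e))} ->
  underpass D f k (count is_head s1) = holonomy C s1.
Proof.
move=> splitE eqC; rewrite /underpass (take_count_heads splitE) big_filter /holonomy.
rewrite big_seq_cond [RHS]big_seq_cond; apply: eq_bigr => e /andP[es he].
by rewrite /headval eqC.
Qed.

Lemma wirtinger_colouring D f : wf D -> wirtinger D f =1 f ->
  colouring D (fun z => f (tail_loc D z.1)).
Proof.
move=> wfD fixf; split=> // k; apply/strand_colouredP => s1 a sg s2 splitE /=.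
rewrite (tail_locE (wf_unique_endpoints wfD) splitE) -fixf; congr (_ ^ _).
exact: underpass_holonomy splitE _.
Qed.

Lemma colouring_wirtinger D C : wf D -> colouring D C ->
  exists2 f, wirtinger D f =1 f &
    {in flatten D, forall e, C e.1 = f (tail_loc D (lab e))}.
Proof.
move=> wfD [colC headE]; have uD := wf_unique_endpoints wfD.
pose f kl := x kl.1 ^ \prod_(e <- take kl.2 (heads D kl.1)) headval C e.
have colE : {in flatten D, forall e, C e.1 = f (tail_loc D (lab e))}.
  move=> e eD; have [k [s1 [s2 splitE]]] := wf_tail wfD eD.
  have -> : C e.1 = C (lab e, false).
    by case: e {eD splitE} => -[a []] sg; rewrite //= headE.
  rewrite (tail_locE uD splitE) /f /= (take_count_heads splitE) big_filter.
  by have /strand_colouredP tailE := colC k; apply: tailE splitE.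
exists f => // -[k l]; congr (_ ^ _); rewrite /underpass big_seq [RHS]big_seq.
apply: eq_bigr => e /mem_take; rewrite mem_filter => /andP[_ /mem_strand_flatten eD].
by rewrite /headval colE.
Qed.

Definition arc_eval D p (kl : nat * nat) : G := eval_word x (arcw D p kl.1 kl.2).

Lemma eval_vword D p k l : eval_word x (vword D p k l) = underpass D (arc_eval D p) k l.
Proof.
rewrite /eval_word big_flatten big_map; apply: eq_bigr => e _; rewrite /uword.
by case: (esign e) => //=; apply: eval_winv.
Qed.

Lemma arc_evalS D p : arc_eval D p.+1 =1 wirtinger D (arc_eval D p).
Proof.
case=> k l; rewrite /arc_eval /= eval_cat eval_winv.
by rewrite eval_cons /= -/(vword D p k l) eval_vword.
Qed.

End Colourings.

Section NilpotentColours.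
Local Open Scope group_scope.
Context (gT : finGroupType) (x : nat -> gT).
Implicit Types (a b g h y : gT) (D : diagram).

Definition lcn_cong j a b : bool := a * b^-1 \in 'L_j.+1([set: gT]).

Lemma memJ_lcnT j g h : g \in 'L_j([set: gT]) -> g ^ h \in 'L_j([set: gT]).
Proof. by move=> Lg; rewrite memJ_norm // (subsetP (lcn_norm j _)) ?inE. Qed.

Lemma lcn_cong0 a b : lcn_cong 0 a b.
Proof. by rewrite /lcn_cong lcn1 inE. Qed.

Lemma lcn_congM j a a' b b' : lcn_cong j a b -> lcn_cong j a' b' ->
  lcn_cong j (a * a') (b * b').
Proof.
move=> ab a'b'; have -> : lcn_cong j (a * a') (b * b') =
    ((a' * b'^-1) ^ a^-1 * (a * b^-1) \in 'L_j.+1([set: gT])).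
  by rewrite /lcn_cong conjgE invgK invMg !mulgA mulgKV.
by rewrite groupM ?memJ_lcnT.
Qed.

Lemma lcn_cong_signg j s a b : lcn_cong j a b -> lcn_cong j (signg s a) (signg s b).
Proof.
case: s => //= ab; rewrite /lcn_cong invgK; have -> : a^-1 * b = (a * b^-1)^-1 ^ a.
  by rewrite conjgE invMg invgK !mulgA mulgKV.
by rewrite memJ_lcnT ?groupV.
Qed.

Lemma lcn_cong_conj j y a b : lcn_cong j a b -> lcn_cong j.+1 (y ^ a) (y ^ b).
Proof.
move=> ab; rewrite /lcn_cong; have -> : y ^ a * (y ^ b)^-1 = [~ a * b^-1, y^-1] ^ b.
  by rewrite -{1}(mulgKV b a) conjgM -conjVg -conjMg commgEl !conjgE invgK !mulgA.
by rewrite memJ_lcnT // lcnSn mem_commg ?inE.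
Qed.

Lemma lcn_cong_wirtinger j D f f' : (forall kl, lcn_cong j (f kl) (f' kl)) ->
  forall kl, lcn_cong j.+1 (wirtinger x D f kl) (wirtinger x D f' kl).
Proof.
move=> ff' kl; apply: lcn_cong_conj; apply: (big_ind2 (lcn_cong j)) => [|????|e _].
- by rewrite /lcn_cong mulgV group1.
- exact: lcn_congM.
exact: lcn_cong_signg.
Qed.

Lemma lcn_cong_arc_evalS p D kl : lcn_cong p (arc_eval x D p.+1 kl) (arc_eval x D p kl).
Proof.
elim: p kl => [|p IH] kl; first exact: lcn_cong0.
by rewrite arc_evalS [arc_eval x D p.+1 kl]arc_evalS; apply: lcn_cong_wirtinger.
Qed.

Lemma lcn_cong_arc_eval p D f kl : wirtinger x D f =1 f ->
  lcn_cong p (f kl) (arc_eval x D p kl).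
Proof.
move=> fixf; elim: p kl => [|p IH] kl; first exact: lcn_cong0.
by rewrite arc_evalS -fixf; apply: lcn_cong_wirtinger.
Qed.

Section Class.
Context (p : nat).
Hypothesis class_le_p : 'L_p.+1([set: gT]) = 1.

Lemma lcn_cong_eq a b : lcn_cong p a b -> a = b.
Proof. by rewrite /lcn_cong class_le_p inE => /eqP/divg1_eq. Qed.

Lemma arc_eval_wirtinger D : wirtinger x D (arc_eval x D p) =1 arc_eval x D p.
Proof. by move=> kl; rewrite -arc_evalS; apply/lcn_cong_eq/lcn_cong_arc_evalS. Qed.

Lemma wirtinger_unique D f : wirtinger x D f =1 f -> f =1 arc_eval x D p.
Proof. by move=> fixf kl; apply/lcn_cong_eq/lcn_cong_arc_eval. Qed.

Lemma colouring_exists D : wf D -> exists C, colouring x D C.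
Proof. by move=> wfD; eexists; apply: wirtinger_colouring (arc_eval_wirtinger D). Qed.

Lemma colouring_holonomy D C i : wf D -> colouring x D C ->
  holonomy C (strand D i) = eval_word x (vword D p i (size (heads D i))).
Proof.
move=> wfD colC; have [f fixf colE] := colouring_wirtinger wfD colC.
rewrite eval_vword /heads size_filter; apply/esym.
apply: (@underpass_holonomy _ _ _ _ _ _ [::]); first by rewrite cats0.
by move=> e ei _; rewrite colE ?(mem_strand_flatten ei) // (wirtinger_unique fixf).
Qed.

End Class.
End NilpotentColours.

Section Moves.
Local Open Scope group_scope.
Context (G : groupType) (x : nat -> G).
Implicit Types (C : nat * bool -> G) (D : diagram) (e : ep) (s : seq ep) (y : G).

Local Notation colouring := (colouring x).
Local Notation strands_coloured := (strands_coloured x).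

Definition transports i D D' : Prop := forall C, colouring D C ->
  exists2 C', colouring D' C' & holonomy C' (strand D' i) = holonomy C (strand D i).

Lemma holonomy_heads C s : all is_head s -> holonomy C s = \prod_(e <- s) headval C e.
Proof. by move/all_filterP=> {2}<-; rewrite big_filter. Qed.

Lemma transports_remove_block i D k P B Q : unique_endpoints D ->
  strand D k = P ++ B ++ Q -> all is_head B ->
  (forall C, colouring D C ->
     (x k ^ holonomy C P) ^ holonomy C B = x k ^ holonomy C P /\
     (k = i -> holonomy C B = 1)) ->
  transports i D (remove_labs (map lab B) D).
Proof.
move=> uD splitE headsB trivB C colC; have [fixB holB] := trivB C colC.
pose keep e := lab e \notin map lab B.
have filterB : filter keep B = [::].
  apply/eqP; rewrite -[_ == _]negbK -has_filter; apply/hasPn => e eB.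
  by rewrite negbK map_f.
have keep_off s : all (fun e => e.1 \notin [seq e'.1 | e' <- B]) s ->
    {in s, forall e, is_head e -> keep e}.
  by move=> /allP off e /off e_off he; apply: head_label_notin.
have [/keep_off keepP /keep_off keepQ off_other] := keys_off_block uD splitE.
have keep_other j jk := keep_off _ (off_other j jk).
exists C; last first.
  rewrite strand_remove_labs; have [ik|ik] := eqVneq i k; last first.
    exact/holonomy_filter/keep_other.
  rewrite ik splitE !filter_cat filterB cat0s !holonomy_cat (holB (esym ik)) mul1g.
  by rewrite !holonomy_filter.
split=> [j|]; last exact: colC.2.
rewrite strand_remove_labs; have [->|jk] := eqVneq j k; last first.
  by apply: strand_coloured_filter (keep_other j jk) (colC.1 j).
have := colC.1 k; rewrite splitE !filter_cat filterB cat0s !strand_coloured_cat.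
case/and3P=> colP _; rewrite fixB => colQ.
by rewrite holonomy_filter // !strand_coloured_filter.
Qed.

Lemma transports_remove_trivial i D B : unique_endpoints D ->
  (exists2 s, s \in D & infix B s) -> all is_head B ->
  (forall C, colouring D C -> \prod_(e <- B) headval C e = 1) ->
  transports i D (remove_labs (map lab B) D).
Proof.
move=> uD /infix_strand [k [P [Q splitE]]] headsB trivB.
apply: (transports_remove_block uD splitE headsB) => C /trivB.
by rewrite -holonomy_heads // => ->; rewrite conjg1.
Qed.

Lemma consecutive_tails_coloured C D k P s Q : strands_coloured C D ->
  strand D k = P ++ s ++ Q -> all (predC is_head) s ->
  {in s, forall e, C e.1 = x k ^ holonomy C P}.
Proof.
move=> colC splitE tails e es; have := colC k; rewrite splitE !strand_coloured_cat.
by rewrite (strand_coloured_tails _ _ tails) => /and3P[_ /allP/(_ e es)/eqP].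
Qed.

Lemma transports_R2 i D D' : wf D' -> R2move D D' -> transports i D' D.
Proof.
move=> wfD' [a [b [eps [_ [-> [heads_ab [s sD' tails_ab]]]]]]].
apply: (transports_remove_trivial i (wf_unique_endpoints wfD') heads_ab) => // C.
case=> colC headE.
have [t [infix_t tails_t a_in b_in]] : exists t, [/\ infix t s, all (predC is_head) t,
    tl a eps \in t & tl b (~~ eps) \in t].
  case/orP: tails_ab => infix_t; [exists [:: tl a eps; tl b (~~ eps)] |
    exists [:: tl b (~~ eps); tl a eps]]; by split; rewrite // !inE eqxx ?orbT.
have [k [P [Q splitE]]] := infix_strand (ex_intro2 _ _ s sD' infix_t).
have tailE := consecutive_tails_coloured colC splitE tails_t.
rewrite big_cons big_seq1 /headval /= signgN !headE.
by rewrite (tailE _ a_in) (tailE _ b_in) mulgV.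
Qed.

Lemma transports_Vn i n D D' : (forall k, x k ^+ n = 1) -> wf D' ->
  Vn_move n D D' -> transports i D' D.
Proof.
move=> xn1 wfD' [L [eps [_ [sizeL [-> [heads_L /infix_strand [k [P [Q splitE]]]]]]]]].
have -> : L = map lab [seq hd a eps | a <- L] by rewrite -map_comp map_id.
apply: (transports_remove_trivial i (wf_unique_endpoints wfD') heads_L).
  by rewrite all_map; apply/allP.
move=> C [colC headE].
have tailE : {in [seq tl a eps | a <- L], forall e, C e.1 = x k ^ holonomy C P}.
  by apply: consecutive_tails_coloured colC splitE _; rewrite all_map; apply/allP.
have headvalE : {in L, forall a, headval C (hd a eps) = signg eps (x k ^ holonomy C P)}.
  by move=> a aL; rewrite /headval /= headE (tailE _ (map_f (tl^~ eps) aL)).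
rewrite big_map big_seq (eq_bigr _ headvalE) -big_seq big_const_seq count_predT.
by rewrite iter_mulg_1 sizeL signgX -conjXg xn1 conj1g signg1.
Qed.

Definition reduced : Prop := forall k g, commute (x k) (x k ^ g).

Lemma reduced_conj k g h : reduced -> commute (x k ^ g) (x k ^ h).
Proof.
move=> redx; have := redx k (h * g^-1) => comm.
by rewrite /commute -(mulgKV g h) conjgM -!conjMg comm.
Qed.

Lemma transports_sv i D D' : reduced -> x i = 1 -> wf D' ->
  sv_move D D' -> transports i D' D.
Proof.
move=> redx xi1 wfD' [a [eps [-> [_ /(nthP [::]) [k _ <-] /andP[tail_a head_a]]]]].
have [P [Q splitE]] : exists P Q, strand D' k = P ++ [:: hd a eps] ++ Q.
  by case/splitPr: head_a => P Q; exists P, Q.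
apply: (transports_remove_block (wf_unique_endpoints wfD') splitE) => // C [colC headE].
have [g tailE] : exists g, C (a, false) = x k ^ g.
  case/splitPr tailE: _ / tail_a => [P' Q']; have /strand_colouredP := colC k.
  by move/(_ _ _ _ _ tailE) => ->; exists (holonomy C P').
have -> : holonomy C [:: hd a eps] = signg eps (x k ^ g).
  by rewrite holonomy_heads // big_seq1 /headval /= headE tailE.
split=> [|->]; last by rewrite xi1 conj1g signg1.
by apply/conjg_fixP/commgP/commute_signg/reduced_conj.
Qed.

Lemma R1move_sv_move D D' : R1move D D' -> sv_move D D'.
Proof.
move=> [a [eps [-> [s sD' infix_s]]]]; exists a, eps; split=> //; exists s => //.
by case/orP: infix_s => /infixP [P [Q ->]]; rewrite !mem_cat !inE !eqxx ?orbT.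
Qed.

Lemma transports_relabel i D D' : relabel D D' -> transports i D' D.
Proof.
move=> [f [_ ->]] C' [colC' headE].
set r := fun e : ep => _ in colC' *.
have strandE k : strand (map (map r) D) k = map r (strand D k) by apply: strand_map.
exists (fun z => C' (f z.1, z.2)); last first.
  by rewrite strandE /holonomy big_map; apply: eq_big.
split=> [k|a]; last exact: headE.
have := colC' k; rewrite strandE; elim: (strand D k) (x k) => //= -[[a b] sg] s IH y.
by rewrite /is_head /headval /=; case: b => [/IH|/andP[-> /IH]].
Qed.

Definition recoloured C D C' D' : Prop :=
  strands_coloured C' D' /\ forall k, holonomy C' (strand D' k) = holonomy C (strand D k).

Lemma recoloured_swap C C' D i p o e1 e2 : unique_endpoints D ->
  pair_at D i p o e1 e2 -> strands_coloured C D ->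
  (forall z, z \notin [:: e1.1; e2.1] -> C' z = C z) ->
  (forall y, strand_coloured C y (ordered_pair o e1 e2) ->
     strand_coloured C' y (ordered_pair (~~ o) e1 e2)) ->
  holonomy C' (ordered_pair (~~ o) e1 e2) = holonomy C (ordered_pair o e1 e2) ->
  recoloured C D C' (swap_adj D i p).
Proof.
move=> uD pairD colC eqC colpair holpair.
have [s1 [s2 [splitE swapE]]] := pair_at_strands pairD.
have eq_off s : all (fun e => e.1 \notin [seq e'.1 | e' <- ordered_pair o e1 e2]) s ->
    {in s, forall e, C' e.1 = C e.1}.
  move=> /allP off e /off e_off; apply: eqC; move: e_off.
  by case: (o); rewrite !inE // orbC.
have [/eq_off eq1 /eq_off eq2 off_other] := keys_off_block uD splitE.
have eq_other k ki := eq_off _ (off_other k ki).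
split=> k; rewrite swapE; have [->|ki] := eqVneq k i.
- have := colC i; rewrite splitE !strand_coloured_cat => /and3P[col1 /colpair colp col2].
  rewrite (eq_strand_coloured _ eq1) col1 (eq_holonomy eq1) colp holpair.
  by rewrite (eq_strand_coloured _ eq2).
- by rewrite (eq_strand_coloured _ (eq_other k ki)).
- by rewrite splitE !holonomy_cat holpair (eq_holonomy eq1) (eq_holonomy eq2).
exact: eq_holonomy (eq_other k ki).
Qed.

Lemma recoloured_swap_tails C D i p o e1 e2 : unique_endpoints D ->
  pair_at D i p o e1 e2 -> ~~ is_head e1 -> ~~ is_head e2 ->
  strands_coloured C D -> recoloured C D C (swap_adj D i p).
Proof.
move=> uD pairD /negPf tail1 /negPf tail2 colC.
apply: recoloured_swap (uD) (pairD) (colC) _ _ _ => //.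
  by move=> y; case: o {pairD} => /=; rewrite tail1 tail2 !andbT andbC.
by case: o {pairD}; rewrite /holonomy !big_cons !big_nil tail1 tail2.
Qed.

Lemma recoloured_swap_head_tail C D i p o a b ea eb :
  let v := C (b, false) ^ signg (ea (+) o) (C (a, true)) in
  unique_endpoints D -> pair_at D i p o (hd a ea) (tl b eb) -> strands_coloured C D ->
  recoloured C D [eta C with (b, false) |-> v] (swap_adj D i p).
Proof.
move=> v uD pairD colC; rewrite {}/v.
apply: recoloured_swap (uD) (pairD) (colC) _ _ _ => [z|y|].
- by rewrite !inE negb_or /= => /andP[_ /negPf ->].
- case: o {pairD}; rewrite /= /headval /= eqxx !andbT => /eqP ->.
    by rewrite addbT signgN conjgK.
  by rewrite xpair_eqE andbF addbF.
by case: o {pairD}; rewrite /holonomy !big_cons !big_nil /= /headval /= xpair_eqE andbF.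
Qed.

Lemma recoloured_swap_heads C D i p o a b ea eb :
  let v := C (b, true) ^ signg (ea (+) o) (C (a, true)) in
  a != b -> unique_endpoints D -> pair_at D i p o (hd a ea) (hd b eb) ->
  strands_coloured C D -> recoloured C D [eta C with (b, true) |-> v] (swap_adj D i p).
Proof.
move=> v a_b uD pairD colC; rewrite {}/v; have /negPf ab : (a, true) != (b, true).
  by rewrite xpair_eqE andbT.
apply: recoloured_swap (uD) (pairD) (colC) _ _ _ => [z|y|].
- by rewrite !inE negb_or /= => /andP[_ /negPf ->].
- by case: o {pairD}.
case: o {pairD}; rewrite /holonomy !big_cons !big_nil /= /headval /=.
  by rewrite ab eqxx !mulg1 addbT signgJ signgN conjgE invgK !mulgA mulgVK.
by rewrite ab eqxx !mulg1 addbF signgJ -conjgC.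
Qed.

Lemma transports_OC i D D' : wf D -> OCmove D D' -> transports i D D'.
Proof.
move=> wfD [j [p [rng [tail1 [tail2 ->]]]]] C [colC headE].
have pairD : pair_at D j p true (ent D j p) (ent D j p.+1) by [].
have uD := wf_unique_endpoints wfD.
have [colC' hol] := recoloured_swap_tails uD pairD tail1 tail2 colC.
by exists C; rewrite ?hol.
Qed.

(* Let t be the colour of the top arc.  Moving the tail of c across the head of a
   conjugates the colour of c by t or its inverse, and so does moving the head of c
   across the head of b; the first sign condition makes the exponents equal. *)
Lemma transports_R3 i D D' : wf D -> R3move D D' -> transports i D D'.
Proof.
move=> wfD [a [b [c [ea [eb [ec [oT [oM [oB]]]]]]]]].
case=> iT [pT [iM [pM [iB [pB [uniq_abc [pairT [pairM [pairB [signs [_ ->]]]]]]]]]]].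
move=> C [colC headE].
have [ab ac bc] : [/\ a != b, a != c & b != c].
  by move: uniq_abc; rewrite /= !inE !negb_or andbT => /andP[/andP[-> ->] ->].
have Cab : C (b, false) = C (a, false).
  have [P [Q [splitE _]]] := pair_at_strands pairT.
  have tailE := consecutive_tails_coloured colC splitE.
  rewrite (tailE _ (tl b eb)) ?(tailE _ (tl a ea)) //;
    by case: (oT); rewrite ?inE ?eqxx ?orbT.
have uD := wf_unique_endpoints wfD.
have [colT holT] := recoloured_swap_tails uD pairT isT isT colC.
have {}uD := unique_endpoints_swap pairT uD.
have {}pairM : pair_at (swap_adj D iT pT) iM pM oM (hd a ea) (tl c ec).
  by apply: pair_at_swap pairT pairM _ _; rewrite !inE !xpair_eqE ?andbF //
    ![c == _]eq_sym (negPf ac) (negPf bc).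
have {}pairB : pair_at (swap_adj D iT pT) iB pB oB (hd b eb) (hd c ec).
  by apply: pair_at_swap pairT pairB _ _; rewrite !inE !xpair_eqE ?andbF.
have [colM holM] := recoloured_swap_head_tail uD pairM colT.
have {}pairB : pair_at (swap_adj (swap_adj D iT pT) iM pM) iB pB oB (hd b eb) (hd c ec).
  by apply: pair_at_swap pairM pairB _ _; rewrite !inE !xpair_eqE ?andbF //
    eq_sym ?(negPf ab) ?(negPf ac).
have {}uD := unique_endpoints_swap pairM uD.
have [colB holB] := recoloured_swap_heads bc uD pairB colM.
eexists; last exact: etrans (holB i) (etrans (holM i) (holT i)).
split=> // k; rewrite /= !xpair_eqE /= !andbT !andbF.
have -> : ea (+) oM = eb (+) oB.
  by move: signs; case: (ea) (eb) (oM) (oB) => [] [] [] [].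
by rewrite !headE Cab.
Qed.

End Moves.

Section Invariance.
Local Open Scope group_scope.
Context (gT : finGroupType) (x : nat -> gT) (i n p : nat).
Hypotheses (class_le_p : 'L_p.+1([set: gT]) = 1) (redx : reduced x).
Hypotheses (xn1 : forall k, x k ^+ n = 1) (xi1 : x i = 1).

Lemma eval_longitude D C : wf D -> colouring x D C ->
  eval_word x (longitude D p i) = holonomy C (strand D i).
Proof.
move=> wfD colC.
by rewrite eval_cat (eval_gen_pow _ xi1) mul1g (colouring_holonomy class_le_p i wfD colC).
Qed.

Lemma transports_longitude D D' : wf D -> wf D' -> transports x i D D' ->
  eval_word x (longitude D p i) = eval_word x (longitude D' p i).
Proof.
move=> wfD wfD' transportDD'; have [C colC] := colouring_exists x class_le_p wfD.
have [C' colC' holE] := transportDD' C colC.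
by rewrite (eval_longitude wfD colC) -holE (eval_longitude wfD' colC').
Qed.

Lemma Vn_sv_equiv_longitude D D' : Vn_sv_equiv n D D' ->
  eval_word x (longitude D p i) = eval_word x (longitude D' p i).
Proof.
elim=> {D D'} [D D' [wfD [wfD' move_DD']] | D | D D' _ -> | D1 D2 D3 _ -> _ ->] //.
case: move_DD' => [mv|[mv|[mv|[mv|[mv|[mv|mv]]]]]].
- exact/esym/(transports_longitude wfD' wfD)/(transports_sv redx xi1 wfD')/R1move_sv_move.
- exact/esym/(transports_longitude wfD' wfD)/(transports_R2 i wfD').
- exact/(transports_longitude wfD wfD')/(transports_R3 i wfD).
- exact/(transports_longitude wfD wfD')/(transports_OC i wfD).
- exact/esym/(transports_longitude wfD' wfD)/(transports_relabel i).
- exact/esym/(transports_longitude wfD' wfD)/(transports_Vn i xn1 wfD').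
- exact/esym/(transports_longitude wfD' wfD)/(transports_sv redx xi1 wfD').
Qed.

End Invariance.

Section UpperMatrices.
Local Open Scope ring_scope.
Context (R : pzRingType) (n : nat).
Implicit Types (a b : 'M[R]_n).

Definition upper j a : bool :=
  [forall s : 'I_n, forall t : 'I_n, (t < s + j)%N ==> (a s t == 0)].

Lemma upperP j a : reflect (forall s t : 'I_n, (t < s + j)%N -> a s t = 0) (upper j a).
Proof.
apply: (iffP forallP) => [up s t lt_t | up s].
  by have /forallP/(_ t)/implyP/(_ lt_t)/eqP := up s.
by apply/forallP => t; apply/implyP => /up ->.
Qed.

Lemma upperW j j' a : (j' <= j)%N -> upper j a -> upper j' a.
Proof.
move=> le_j /upperP up; apply/upperP => s t lt_t; apply: up.
by apply: leq_trans lt_t _; rewrite leq_add2l.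
Qed.

Lemma upper1 : upper 0 1.
Proof.
apply/upperP => s t; rewrite addn0 mxE -(inj_eq val_inj) eq_sym /=.
by move/ltn_eqF->.
Qed.

Lemma upperD j a b : upper j a -> upper j b -> upper j (a + b).
Proof.
move=> /upperP ua /upperP ub; apply/upperP => s t lt_t.
by rewrite mxE ua ?ub ?addr0.
Qed.

Lemma upperN j a : upper j a -> upper j (- a).
Proof. by move=> /upperP ua; apply/upperP => s t lt; rewrite mxE ua ?oppr0. Qed.

Lemma upperM i j a b : upper i a -> upper j b -> upper (i + j) (a * b).
Proof.
move=> /upperP ua /upperP ub; apply/upperP => s t lt; rewrite mxE big1 // => u _.
have [/ua -> | le_u] := ltnP u (s + i); first by rewrite mul0r.
by rewrite ub ?mulr0 //; apply: leq_trans lt _; rewrite addnA leq_add2r.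
Qed.

Lemma upper_eq0 a : upper n a -> a = 0.
Proof.
move=> /upperP ua; apply/matrixP => s t; rewrite ua ?mxE //.
by rewrite (leq_trans (ltn_ord t)) ?leq_addl.
Qed.

End UpperMatrices.

Section Unitriangular.
Local Open Scope group_scope.
Context (R : finComUnitRingType) (d : nat).
Local Notation GLt := {unit 'M[R]_d.+1}.
Implicit Types (g h : GLt).

Definition unitri j : {set GLt} := [set g | upper j (val g - 1)%R].

Lemma unitri_upper j g : g \in unitri j -> upper 0 (val g).
Proof.
rewrite inE => /(upperW (leq0n j)) up.
by rewrite -[val g](subrK 1%R) upperD ?upper1.
Qed.

Lemma unitri_group_set j : group_set (unitri j).
Proof.
apply/group_setP; split=> [|g h gU hU].
  by rewrite inE subrr; apply/upperP => s t _; rewrite mxE.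
have up_h := unitri_upper hU; move: gU hU; rewrite !inE => up_g1 up_h1.
have -> : (val (g * h)%g - 1 = (val g - 1) * val h + (val h - 1))%R.
  by rewrite mulrBl mul1r addrA subrK.
by rewrite upperD // -[j]addn0 upperM.
Qed.

Canonical unitri_group j := Group (unitri_group_set j).

Lemma unitri_top : unitri d.+1 = 1.
Proof.
apply/trivgP/subsetP => g; rewrite !inE => /upper_eq0 /eqP.
by rewrite subr_eq0.
Qed.

Lemma commg_unitri i j : [~: unitri i, unitri j] \subset unitri (i + j).
Proof.
rewrite gen_subG; apply/subsetP => _ /imset2P[g h gU hU ->].
have up_ghV : upper 0 (val (g^-1 * h^-1)%g).
  by apply: (@upperM _ _ 0 0); [apply: (@unitri_upper i) | apply: (@unitri_upper j)];
    rewrite groupV.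
rewrite inE; move: gU hU up_ghV; rewrite !inE => up_g up_h up_ghV.
have -> : (val [~ g, h] - 1 = val (g^-1 * h^-1)%g
    * ((val g - 1) * (val h - 1) - (val h - 1) * (val g - 1)))%R.
  have shiftM (a b : 'M[R]_d.+1) : ((a - 1) * (b - 1) = a * b - (a + b - 1))%R.
    by rewrite mulrBl mul1r mulrBr mulr1 -addrA -opprD addrA.
  rewrite !shiftM [(val h + _)%R]addrC; move: (val g + val h - 1)%R => c.
  rewrite opprB addrA subrK mulrBr -!FinRing.val_unitM.
  by rewrite -[(_ * (h * g))%g]mulgA mulKg mulVg -mulgA.
rewrite -[(i + j)%N]add0n upperM // upperD ?upperM // upperN // addnC.
exact: upperM.
Qed.

Lemma lcn_unitri j : 'L_j.+1(unitri 1) \subset unitri j.+1.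
Proof.
elim: j => [|j IH]; first by rewrite lcn1.
rewrite lcnSn; apply: subset_trans (commSg _ IH) _.
by rewrite -[j.+2]addn1 commg_unitri.
Qed.

Lemma lcn_unitri_trivial p : d <= p -> 'L_p.+1([set: [subg unitri 1]]) = 1.
Proof.
move=> le_dp; rewrite -(im_subg (unitri_group 1)) -morphim_lcn //.
have -> : 'L_p.+1(unitri 1) = 1.
  apply/trivgP; rewrite -unitri_top.
  by apply: subset_trans (lcn_sub_leq _ _) (lcn_unitri d).
exact: morphim1.
Qed.

End Unitriangular.

Section SuperdiagonalMatrices.
Local Open Scope ring_scope.
Context (R : pzRingType) (M : seq nat).
Local Notation d := (size M).
Implicit Types (a : 'M[R]_d.+1) (s t : 'I_d.+1).

Definition magnus_nil k : 'M[R]_d.+1 :=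
  \matrix_(s, t) ((t == s.+1 :> nat) && (nth 0%N M s == k))%:R.

Lemma upper_magnus_nil k : upper 1 (magnus_nil k).
Proof. by apply/upperP => s t; rewrite mxE addn1 => /ltn_eqF ->. Qed.

Lemma magnus_nil_notin k : k \notin M -> magnus_nil k = 0.
Proof.
move=> kM; apply/matrixP => s t; rewrite !mxE; case: andP => // -[/eqP ts /eqP Mk].
by case/negP: kM; rewrite -Mk mem_nth // -ltnS -ts.
Qed.

Lemma magnus_nil_mulE k a s t : (magnus_nil k * a) s t =
  if (s < d)%N && (nth 0%N M s == k) then a (inord s.+1) t else 0.
Proof.
rewrite mxE; case: ltnP => [lt_s | ge_s] /=; last first.
  by rewrite big1 // => u _; rewrite mxE ltn_eqF ?mul0r // (leq_trans (ltn_ord u)).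
rewrite (bigD1 (inord s.+1)) //= mxE inordK // eqxx big1 => [|u u_s].
  by case: eqP; rewrite ?mul1r ?mul0r addr0.
by rewrite mxE -(inordK (lt_s : s.+1 < d.+1)%N) (inj_eq val_inj) (negPf u_s) mul0r.
Qed.

(* The only nonzero entry of N sits at some (s, s + 1), since M is non-repeated,
   and the (s + 1, s) entry of a is below the diagonal. *)
Lemma magnus_nil_sandwich k a : uniq M -> upper 0 a ->
  magnus_nil k * (a * magnus_nil k) = 0.
Proof.
move=> uniqM /upperP up_a; apply/matrixP => s t; rewrite magnus_nil_mulE [RHS]mxE.
case: andP => // -[lt_s /eqP Ms]; rewrite mxE big1 // => u _; rewrite mxE.
case: andP => [[/eqP tu Mu] | _]; last by rewrite mulr0.
have lt_u : (u < d)%N by rewrite -ltnS -tu.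
have us : u = s :> nat by move: Mu; rewrite -Ms nth_uniq // => /eqP.
by rewrite up_a ?mul0r // us addn0 inordK.
Qed.

Lemma magnus_nil_sq k : uniq M -> magnus_nil k * magnus_nil k = 0.
Proof. by move=> uniqM; rewrite -[X in _ * X]mul1r magnus_nil_sandwich ?upper1. Qed.

End SuperdiagonalMatrices.

Lemma expr1D_sq0 (R : pzRingType) (a : R) n : (a * a = 0 -> (1 + a) ^+ n = 1 + a *+ n)%R.
Proof.
move=> a_sq0; elim: n => [|n IH]; first by rewrite expr0 mulr0n addr0.
by rewrite exprS IH mulrDl mul1r mulrDr mulr1 mulrnAr a_sq0 mul0rn addr0 mulrSr addrA.
Qed.

Lemma mcoef_cons_uniq z w L : uniq L ->
  mcoef (z :: w) L = (mcoef w L +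
    (if L is y :: L' then (if y == z.1 then sgn (~~ z.2) else 0) * mcoef w L' else 0))%R.
Proof.
have coef_nil : letter_coef z [::] = 1%R by rewrite /letter_coef /= expr0 if_same.
case: L => [_|y L uyL].
  by rewrite /= big_ord_recl big_ord0 /= coef_nil mul1r addr0.
rewrite /= !big_ord_recl /= coef_nil mul1r take0 drop0 big1 ?addr0 => [|t _].
  congr (_ + _ * _)%R; rewrite /letter_coef /sgn /= andbT eqseq_cons andbT.
  by case: z.2; case: eqP => //=; rewrite expr1.
case: L uyL t => [|y' L] /= uyL t; first by case: t.
rewrite /letter_coef /= !eqseq_cons andbF.
case: eqP => [yz|_] /=; last by rewrite if_same mul0r.
case: eqP => [y'z|_] /=; last by rewrite if_same mul0r.
by move: uyL; rewrite yz y'z mem_head.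
Qed.

Section MagnusRepresentation.
Local Open Scope ring_scope.
Context (R : finComUnitRingType) (M : seq nat) (uniqM : uniq M).
Local Notation d := (size M).
Local Notation N := (magnus_nil R M).
Local Notation U := [subg unitri R d 1].

Definition magnus_mx (g : U) : 'M[R]_d.+1 := val (sgval g).

Lemma magnus_mx_inj : injective magnus_mx.
Proof. by move=> g h /val_inj/val_inj. Qed.

Lemma magnus_mxM g h : magnus_mx (g * h)%g = magnus_mx g * magnus_mx h.
Proof. by rewrite /magnus_mx sgvalM // !inE. Qed.

Lemma upper_magnus_mx g : upper 0 (magnus_mx g).
Proof. exact/unitri_upper/(valP g). Qed.

Lemma magnus_genVl k : (1 - N k) * (1 + N k) = 1.
Proof. by rewrite mulrBl mul1r mulrDr mulr1 magnus_nil_sq // addr0 addrK. Qed.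

Lemma magnus_genVr k : (1 + N k) * (1 - N k) = 1.
Proof. by rewrite mulrBr mulr1 mulrDl mul1r magnus_nil_sq // addr0 addrK. Qed.

Lemma magnus_gen_unit k : 1 + N k \is a GRing.unit.
Proof. by apply/unitrP; exists (1 - N k); rewrite magnus_genVl magnus_genVr. Qed.

Definition magnus_gen k : U := subg _ (FinRing.unit _ (magnus_gen_unit k)).

Lemma magnus_mx_gen k : magnus_mx (magnus_gen k) = 1 + N k.
Proof. by rewrite /magnus_mx subgK // inE /= addrC addKr upper_magnus_nil. Qed.

Lemma magnus_mx_signg_gen b k :
  magnus_mx (signg b (magnus_gen k)) = 1 + (sgn b)%:~R *: N k.
Proof.
case: b => /=; first by rewrite magnus_mx_gen mulr1z scale1r.
apply: (mulIr (magnus_gen_unit k)); rewrite mulrNz mulr1z scaleN1r magnus_genVl.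
by rewrite -{1}magnus_mx_gen -magnus_mxM mulVg.
Qed.

Lemma magnus_gen_reduced : reduced magnus_gen.
Proof.
move=> k g; apply: magnus_mx_inj; rewrite !magnus_mxM magnus_mx_gen.
set a := magnus_mx g^-1; set b := magnus_mx g.
have ab : a * b = 1 by rewrite -magnus_mxM mulVg.
have -> : a * ((1 + N k) * b) = 1 + a * (N k * b) by rewrite mulrDl mul1r mulrDr ab.
apply: commrD; first exact: commr1.
apply/commr_sym/commrD; first exact: commr1.
rewrite /GRing.comm -!mulrA magnus_nil_sandwich ?upper_magnus_mx // mulr0.
by rewrite [a * _]mulrA [N k * _]mulrA magnus_nil_sandwich ?upper_magnus_mx ?mul0r.
Qed.

Lemma magnus_gen_exp k n : n%:R = 0 :> R -> (magnus_gen k ^+ n)%g = 1%g.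
Proof.
move=> n0; apply: magnus_mx_inj.
have -> : magnus_mx (magnus_gen k ^+ n)%g = (1 + N k) ^+ n.
  by elim: n {n0} => // n IH; rewrite expgS magnus_mxM IH magnus_mx_gen exprS.
by rewrite expr1D_sq0 ?magnus_nil_sq // -scaler_nat n0 scale0r addr0.
Qed.

Lemma magnus_gen_notin k : k \notin M -> magnus_gen k = 1%g.
Proof.
by move=> kM; apply: magnus_mx_inj; rewrite magnus_mx_gen magnus_nil_notin // addr0.
Qed.

Lemma magnus_mcoef w (s : 'I_d.+1) :
  magnus_mx (eval_word magnus_gen w) s ord_max = (mcoef w (drop s M))%:~R.
Proof.
elim: w s => [|z w IH] s.
  rewrite /eval_word big_nil [LHS]mxE -(inj_eq val_inj) /= -size_eq0 size_drop subn_eq0.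
  by rewrite eqn_leq -ltnS ltn_ord /=; case: leqP.
rewrite eval_cons magnus_mxM magnus_mx_signg_gen mulrDl mul1r mxE IH.
rewrite mcoef_cons_uniq ?drop_uniq // rmorphD /=; congr (_ + _).
rewrite -scalerAl mxE magnus_nil_mulE; case: ltnP => [lt_s | ge_s] /=; last first.
  by rewrite drop_oversize // mulr0.
rewrite (drop_nth 0%N lt_s) IH inordK // rmorphM.
by case: ifP; rewrite ?mul0r ?mulr0.
Qed.

End MagnusRepresentation.

Lemma Vn_sv_equiv_mcoef_longitude (R : finComUnitRingType) (n i p : nat)
    (M : seq nat) (D D' : diagram) :
  (n%:R = 0 :> R)%R -> uniq M -> i \notin M -> size M <= p -> Vn_sv_equiv n D D' ->
  ((mcoef (longitude D p i) M)%:~R = (mcoef (longitude D' p i) M)%:~R :> R)%R.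
Proof.
move=> n0 uniqM iM le_p eqvDD'; rewrite -[M]drop0 -!(magnus_mcoef R uniqM _ ord0).
congr (magnus_mx _ _ _); apply: Vn_sv_equiv_longitude eqvDD' => [||k|].
- exact: lcn_unitri_trivial.
- exact: magnus_gen_reduced.
- exact: magnus_gen_exp.
exact: magnus_gen_notin.
Qed.

Lemma intr_Zp_eqz_mod n (a b : int) : 1 < n ->
  (a%:~R = b%:~R :> 'Z_n)%R -> (a == b %[mod n%:Z])%Z.
Proof.
move=> n_gt1 ab; rewrite eqz_mod_dvd.
have : ((a - b)%:~R = 0 :> 'Z_n)%R by rewrite rmorphB /= ab subrr.
have dvd_nat k : (k%:R = 0 :> 'Z_n)%R -> n %| k.
  by move/(congr1 val); rewrite /= val_Zp_nat // => /eqP.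
case: (a - b)%R => k; first by rewrite -pmulrn => /dvd_nat.
by rewrite NegzE mulrNz => /eqP; rewrite oppr_eq0 -pmulrn => /eqP /dvd_nat.
Qed.

Theorem theorem3p1 (m n : nat) (sigma sigma' : diagram) :
  0 < n ->
  size sigma = m -> size sigma' = m -> wf sigma -> wf sigma' ->
  Vn_sv_equiv n sigma sigma' ->
  forall I : seq 'I_m, uniq I ->
    (mu_w sigma (map val I) == mu_w sigma' (map val I) %[mod (n%:Z)])%Z.
Proof.
move=> n_gt0 _ _ _ _ eqv I uniqI.
have [n_gt1 | n_le1] := ltnP 1 n; last first.
  by have /eqP -> : n == 1 by [rewrite eqn_leq n_le1]; rewrite !modz1.
have: uniq (map val I) by rewrite map_inj_uniq //; apply: val_inj.
case: (map val I) => [//|j J]; rewrite lastI rcons_uniq => /andP[iM uniqM].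
apply: intr_Zp_eqz_mod => //; rewrite /mu_w -lastI.
apply: Vn_sv_equiv_mcoef_longitude eqv => //; last by rewrite size_belast /=.
by apply/val_inj; rewrite /= val_Zp_nat // modnn.
Qed.
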